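(* Let $N\ge1$, let $k$ be a non-negative multiplicity function on a reduced root system on $\mathbb{R}^N$ and let $a>0$ be such that $\lambda_{k,a,0}=\frac{2\langle k\rangle+N-2}{a}>-1$. Then the $(k,a)$-generalized Schwartz space $\mathscr{S}_{k,a}(\mathbb{R}^N)$ is stable under the $(k,a)$-generalized Fourier transform $\mathscr{F}_{k,a}$.
   Context: $\mathbb{N}=\{0,1,2,\dots\}$, $\mathbb{R}_+=(0,\infty)$; functions are complex-valued. A reduced root system $\mathscr{R}$ on $\mathbb{R}^N$ is a finite (possibly empty) subset of $\mathbb{R}^N\setminus\{0\}$, stable under the orthogonal reflections $r_\alpha$ in $(\mathbb{R}\alpha)^\perp$ ($\alpha\in\mathscr{R}$), with $\mathscr{R}\cap\mathbb{R}\alpha=\{\pm\alpha\}$. A multiplicity function is a map $k:\mathscr{R}\to\mathbb{C}$ invariant under the group generated by the $r_\alpha$; it is non-negative if all $k_\alpha\ge0$. Put $\langle k\rangle=\frac12\sum_{\alpha\in\mathscr{R}}k_\alpha$. The Dunkl Laplacian is $\Delta_k=\sum_{j=1}^N T_j^2$ with $T_jf=\partial_jf+\frac12\sum_{\alpha\in\mathscr{R}}k_\alpha\alpha_j\frac{f(x)-f(r_\alpha x)}{\langle\alpha,x\rangle}$. Let $E_x=\sum_jx_j\partial_{x_j}$ and $w_{k,a}(x)=|x|^{a-2}\prod_{\alpha\in\mathscr{R}}|\langle\alpha,x\rangle|^{k_\alpha}$. Let $\mathcal{H}^m_k(S^{N-1})$ be the space of restrictions to $S^{N-1}$ of homogeneous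 polynomials $p$ of degree $m$ with $\Delta_kp=0$. For $p$ on $S^{N-1}$ and $f$ on $\mathbb{R}_+$, $(p\otimes f)(r\omega)=p(\omega)f(r)$. Let $\mathbf{h}=\begin{pmatrix}1&0\\0&-1\end{pmatrix}$, $\mathbf{e}^+=\begin{pmatrix}0&1\\0&0\end{pmatrix}$, $\mathbf{e}^-=\begin{pmatrix}0&0\\1&0\end{pmatrix}$. The Lie algebra representation $\omega_{k,a}$ of $\mathfrak{sl}(2,\mathbb{R})$ on $C^\infty(\mathbb{R}^N\setminus\{0\})$ is given by $\omega_{k,a}(\mathbf{h})=\frac2aE_x+\frac{2\langle k\rangle+a+N-2}{a}$, $\omega_{k,a}(\mathbf{e}^+)=\frac ia|x|^a$, $\omega_{k,a}(\mathbf{e}^-)=\frac ia|x|^{2-a}\Delta_k$. Put $\lambda_{k,a,m}=\frac{2m+2\langle k\rangle+N-2}{a}$, $L_l^\lambda(t)=\sum_{j=0}^l\frac{(-1)^j}{j!}\binom{\lambda+l}{l-j}t^j$, and $$f_{k,a,m;l}(r)=\Big(\tfrac{2^{\lambda_{k,a,m}+1}\Gamma(l+1)}{a^{\lambda_{k,a,m}}\Gamma(\lambda_{k,a,m}+l+1)}\Big)^{1/2}r^mL_l^{\lambda_{k,a,m}}(\tfrac2ar^a)e^{-r^a/a}.$$ Let $W_{k,a}(\mathbb{R}^N)=\bigoplus_{m\in\mathbb{N}}\mathcal{H}^m_k(S^{N-1})\otimes\mathrm{span}_{\mathbb{C}}\{f_{k,a,m;l}:l\in\mathbb{N}\}$.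 For $k$ non-negative, $a>0$ and $\lambda_{k,a,0}>-1$, $\Omega_{k,a}$ is the unique unitary representation of the universal covering group $\widetilde{SL}(2,\mathbb{R})$ on $L^2(\mathbb{R}^N,w_{k,a}(x)\,dx)$ whose space of $\widetilde{SO}(2)$-finite vectors is $W_{k,a}(\mathbb{R}^N)$ and whose infinitesimal action on $W_{k,a}(\mathbb{R}^N)$ is $\omega_{k,a}$ (existence and uniqueness are known, due to Ben Saïd–Kobayashi–Ørsted). Here $\widetilde{SO}(2)$ is the Lie subgroup with Lie algebra $\mathfrak{so}(2)$. A vector $v$ of a unitary representation $(\pi,\mathcal{H})$ of a Lie group $G$ is smooth if $g\mapsto\pi(g)v$ is a smooth map $G\to\mathcal{H}$. $\mathscr{S}_{k,a}(\mathbb{R}^N)$ is the space of smooth vectors for $\Omega_{k,a}$. The $(k,a)$-generalized Fourier transform is the unitary operator $$\mathscr{F}_{k,a}=e^{\frac{i\pi}{2}(\lambda_{k,a,0}+1)}\,\Omega_{k,a}\Big(\exp_{\widetilde{SL}(2,\mathbb{R})}\Big(\tfrac\pi2\begin{pmatrix}0&-1\\1&0\end{pmatrix}\Big)\Big).$$ *)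

(* Defs.v *)
From HB Require Import structures.
From mathcomp Require Import all_boot all_order all_algebra finmap.
From mathcomp Require Import generic_quotient ring_quotient complex.
From mathcomp Require Import all_classical all_reals all_analysis.
From mathcomp Require Import measurable_realfun.

Set Implicit Arguments.
Unset Strict Implicit.
Unset Printing Implicit Defensive.

Import Order.TTheory GRing.Theory Num.Theory.
Import numFieldNormedType.Exports.

Local Open Scope classical_set_scope.
Local Open Scope ring_scope.

Section ComplexL2.
Local Open Scope quotient_scope.
Context d (T : measurableType d) (R : realType).
Variable mu : {measure set T -> \bar R}.
Implicit Types (f g : T -> Rcomplex R).

Definition cabs (z : Rcomplex R) : R := Normc.normc z.

Lemma cabs_ge0 z : 0 <= cabs z.
Proof. by case: z => a b; exact: sqrtr_ge0. Qed.

Lemma cabsC z : (cabs z)%:C%C = `|z : R[i]|.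
Proof. by case: z. Qed.

Lemma ler_cabsD z w : cabs (z + w) <= cabs z + cabs w.
Proof. by rewrite -lecR rmorphD /= !cabsC; exact: ler_normD. Qed.

Lemma cabsZ (a : R) z : cabs (a *: z) = `|a| * cabs z.
Proof.
case: z => x y; rewrite /cabs /=.
by rewrite !exprMn -mulrDr sqrtrM ?sqr_ge0// sqrtr_sqr.
Qed.

Lemma cabsM (c : R[i]) (z : R[i]) : cabs (c * z) = cabs c * cabs z.
Proof. exact: Normc.normcM. Qed.

Lemma cabs0_eq0 z : cabs z = 0 -> z = 0.
Proof. exact: Normc.eq0_normc. Qed.

Definition cmeasurable f :=
  measurable_fun [set: T] (fun x => complex.Re (f x)) /\
  measurable_fun [set: T] (fun x => complex.Im (f x)).

Lemma measurable_cabs f : cmeasurable f ->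
  measurable_fun [set: T] (fun x => cabs (f x)).
Proof.
move=> [mr mi].
rewrite (_ : (fun x => _) = (fun x =>
  (complex.Re (f x) ^+ 2 + complex.Im (f x) ^+ 2) `^ 2^-1)); last first.
  apply/funext => x; rewrite powR12_sqrt ?addr_ge0 ?sqr_ge0//.
  by rewrite /cabs; case: (f x).
apply: (@measurableT_comp _ _ _ _ _ _ (@powR R ^~ 2^-1)).
  exact: measurable_powR.
by apply: measurable_funD; apply: measurable_funX.
Qed.

Definition L2_norm f : \bar R := 'N[mu]_2%:E[(fun x => (cabs (f x))%:E)].

Definition L2_pred : {pred T -> Rcomplex R} :=
  [pred f | `[< cmeasurable f /\ (L2_norm f < +oo)%E >] ].

Lemma L2_predP f : reflect (cmeasurable f /\ (L2_norm f < +oo)%E) (f \in L2_pred).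
Proof. exact: asboolP. Qed.

Lemma cmeasurableD f g : cmeasurable f -> cmeasurable g -> cmeasurable (f + g).
Proof.
move=> [fr fi] [gr gi]; split.
  rewrite (_ : (fun x => _) = (fun x => complex.Re (f x) + complex.Re (g x)));
    first exact: measurable_funD.
  by apply/funext => x; rewrite !fctE raddfD.
rewrite (_ : (fun x => _) = (fun x => complex.Im (f x) + complex.Im (g x)));
  first exact: measurable_funD.
by apply/funext => x; rewrite !fctE raddfD.
Qed.

Lemma cmeasurableM (c : R[i]) f : cmeasurable f ->
  cmeasurable (fun x => c * (f x : R[i])).
Proof.
case: c => a b [fr fi]; split.
  rewrite (_ : (fun x => _) =
      (fun x => a * complex.Re (f x) - b * complex.Im (f x))); last first.
    by apply/funext => x; case: (f x).
  by apply: measurable_funB; apply: measurable_funM.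
rewrite (_ : (fun x => _) =
    (fun x => a * complex.Im (f x) + b * complex.Re (f x))); last first.
  by apply/funext => x; case: (f x).
by apply: measurable_funD; apply: measurable_funM.
Qed.

Lemma le_Lnorm2 (u v : T -> R) :
  measurable_fun setT u -> measurable_fun setT v ->
  (forall x, 0 <= u x <= v x) ->
  ('N[mu]_2%:E[(fun x => (u x)%:E)] <= 'N[mu]_2%:E[(fun x => (v x)%:E)])%E.
Proof.
move=> mu_ mv uv; rewrite unlock.
have mP (w : T -> R) : measurable_fun setT w ->
    measurable_fun setT (fun x => `|(w x)%:E| `^ 2)%E.
  move=> mw; rewrite (_ : (fun x => _) = (EFin \o (fun x => `|w x| `^ 2))).
    apply/measurable_EFinP/(@measurableT_comp _ _ _ _ _ _ (@powR R ^~ 2)).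
      exact: measurable_powR.
    exact: measurableT_comp.
  by [].
apply: gt0_ler_poweR.
- by rewrite invr_ge0.
- by rewrite in_itv/= leey andbT integral_ge0// => x _; exact: poweR_ge0.
- by rewrite in_itv/= leey andbT integral_ge0// => x _; exact: poweR_ge0.
apply: ge0_le_integral => //.
- by move=> x _; exact: poweR_ge0.
- exact: mP.
- exact: mP.
move=> x _; have /andP[u0 uvx] := uv x.
rewrite !poweR_EFin lee_fin ge0_ler_powR ?nnegrE//.
by rewrite !ger0_norm// (le_trans u0).
Qed.

Lemma ae_eq_Lnorm2 (u v : T -> R) :
  measurable_fun setT u -> measurable_fun setT v ->
  {ae mu, forall x, u x = v x} ->
  ('N[mu]_2%:E[(fun x => (u x)%:E)] = 'N[mu]_2%:E[(fun x => (v x)%:E)])%E.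
Proof.
move=> mu_ mv uv; rewrite unlock; congr (_ `^ _)%E.
have mP (w : T -> R) : measurable_fun setT w ->
    measurable_fun setT (fun x => `|(w x)%:E| `^ 2)%E.
  move=> mw; rewrite (_ : (fun x => _) = (EFin \o (fun x => `|w x| `^ 2))).
    apply/measurable_EFinP/(@measurableT_comp _ _ _ _ _ _ (@powR R ^~ 2)).
      exact: measurable_powR.
    exact: measurableT_comp.
  by [].
apply: ge0_ae_eq_integral => //; [exact: mP|exact: mP| | | ].
- by move=> x _; exact: poweR_ge0.
- by move=> x _; exact: poweR_ge0.
by apply: filterS uv => x -> _.
Qed.

Lemma L2_normD f g : cmeasurable f -> cmeasurable g ->
  (L2_norm (f + g)%R <= L2_norm f + L2_norm g)%E.
Proof.
move=> mf mg.
pose u := (fun x => cabs (f x)) \+ (fun x => cabs (g x)).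
apply: (@le_trans _ _ 'N[mu]_2%:E[EFin \o u]%E); last first.
  by apply: minkowski_EFin; rewrite ?ler1n//; exact: measurable_cabs.
apply: le_Lnorm2.
- by apply: measurable_cabs; exact: cmeasurableD.
- by apply: measurable_funD; exact: measurable_cabs.
- by move=> x; rewrite cabs_ge0 ler_cabsD.
Qed.

Lemma L2_normM (c : R[i]) f : cmeasurable f ->
  L2_norm (fun x => c * (f x : R[i])) = ((cabs c)%:E * L2_norm f)%E.
Proof.
move=> mf; rewrite /L2_norm unlock.
under eq_integral.
  move=> x _.
  rewrite cabsM EFinM abseM poweRM//= ger0_norm ?cabs_ge0//.
  over.
rewrite ge0_integralZl//; last 2 first.
- rewrite (_ : (fun x => _) = (EFin \o (fun x => `|cabs (f x)| `^ 2)))//.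
  apply/measurable_EFinP/(@measurableT_comp _ _ _ _ _ _ (@powR R ^~ 2)).
    exact: measurable_powR.
  by apply: measurableT_comp => //; exact: measurable_cabs.
- by rewrite lee_fin powR_ge0.
rewrite poweRM ?lee_fin ?powR_ge0 ?integral_ge0//.
by rewrite poweR_EFin -powRrM mulfV// powRr1// cabs_ge0.
Qed.

Lemma scaleE (a : R) f : a *: f = (fun x => a%:C%C * (f x : R[i])).
Proof.
by apply/funext => x; rewrite !fctE; case: (f x) => u v; rewrite /GRing.scale/=;
  congr Complex; rewrite mul0r ?subr0 ?addr0.
Qed.

Lemma L2_predM (c : R[i]) f : f \in L2_pred ->
  (fun x => c * (f x : R[i])) \in L2_pred.
Proof.
move=> /L2_predP[mf lf]; apply/L2_predP; split; first exact: cmeasurableM.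
by rewrite L2_normM// lte_mul_pinfty// lee_fin cabs_ge0.
Qed.

Lemma L2_pred_submod_closed : submod_closed L2_pred.
Proof.
split.
  apply/L2_predP; split; first by split; exact: measurable_cst.
  rewrite /L2_norm (_ : (fun x => _) = cst 0%E) ?Lnorm0//.
  by apply/funext => x; rewrite /cabs/= expr0n/= addr0 sqrtr0.
move=> a f g fL /L2_predP[mg lg].
have : a *: f \in L2_pred by rewrite scaleE; exact: L2_predM.
move=> /L2_predP[mf lf]; apply/L2_predP; split; first exact: cmeasurableD.
by rewrite (le_lt_trans (L2_normD _ _))// lte_add_pinfty.
Qed.

HB.instance Definition _ := GRing.isSubmodClosed.Build _ _ L2_pred
  L2_pred_submod_closed.

(* square-integrable complex functions *)
Record L2fun := MkL2fun { L2val :> T -> Rcomplex R; _ : L2val \in L2_pred }.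

HB.instance Definition _ := [isSub for L2val].
HB.instance Definition _ := [Choice of L2fun by <:].
HB.instance Definition _ := [SubChoice_isSubLmodule of L2fun by <:].

Definition L2fun_mulc (c : R[i]) (f : L2fun) : L2fun :=
  MkL2fun (L2_predM c (valP f)).

Lemma L2fun_mulcE (c : R[i]) (f : L2fun) x :
  L2fun_mulc c f x = c * (f x : R[i]).
Proof. by []. Qed.

Lemma L2funDE (f g : L2fun) x : (f + g) x = f x + g x.
Proof. by []. Qed.

Lemma L2funBE (f g : L2fun) x : (f - g) x = f x - g x.
Proof. by []. Qed.

Lemma L2funZE (a : R) (f : L2fun) x : (a *: f) x = a%:C%C * (f x : R[i]).
Proof. exact: (congr1 (fun h => h x) (scaleE a f)). Qed.

Definition ae0 : {pred L2fun} :=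
  [pred f : L2fun | `[< {ae mu, forall x, f x = 0} >] ].

Lemma ae0_zmod_closed : zmod_closed ae0.
Proof.
split; first by apply/asboolP; exact: aeW.
move=> f g /asboolP f0 /asboolP g0; apply/asboolP.
by apply: filterS2 f0 g0 => x fx gx; rewrite L2funBE fx gx subr0.
Qed.

HB.instance Definition _ := GRing.isZmodClosed.Build _ ae0 ae0_zmod_closed.

(* L^2(T, mu; C), the quotient by almost everywhere equality *)
Definition L2 : Type := Quotient.quot ae0.
HB.instance Definition _ := GRing.Zmodule.on L2.
HB.instance Definition _ := EqQuotient.on L2.

Lemma pi_L2P (f g : L2fun) :
  \pi_L2 f = \pi_L2 g <-> {ae mu, forall x, f x = g x}.
Proof.
split=> [/eqP|fg]; last apply/eqP.
  rewrite -Quotient.idealrBE => /asboolP.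
  by apply: filterS => x; rewrite L2funBE => /eqP; rewrite subr_eq0 => /eqP.
rewrite -Quotient.idealrBE; apply/asboolP.
by apply: filterS fg => x fgx; rewrite L2funBE fgx subrr.
Qed.

Lemma repr_L2 (f : L2fun) : {ae mu, forall x, repr (\pi_L2 f) x = f x}.
Proof. by apply/pi_L2P; rewrite reprK. Qed.

Lemma pi_L2D (f g : L2fun) : \pi_L2 (f + g) = \pi_L2 f + \pi_L2 g.
Proof. by rewrite piE. Qed.

(* multiplication by a complex scalar; the module structure of L2 declared
   below is the real one *)
Definition cscale (c : R[i]) (v : L2) : L2 := \pi_L2 (L2fun_mulc c (repr v)).

Lemma cscale_pi (c : R[i]) (f : L2fun) :
  cscale c (\pi_L2 f) = \pi_L2 (L2fun_mulc c f).
Proof.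
apply/pi_L2P; apply: filterS (repr_L2 f) => x.
by rewrite !L2fun_mulcE => ->.
Qed.

Lemma cscaleA (b c : R[i]) v : cscale b (cscale c v) = cscale (b * c) v.
Proof.
rewrite -[v]reprK (cscale_pi c) !cscale_pi; apply/pi_L2P; apply: aeW => x.
by rewrite !L2fun_mulcE mulrA.
Qed.

Lemma cscale1 v : cscale 1 v = v.
Proof.
rewrite -[v]reprK !cscale_pi; apply/pi_L2P; apply: aeW => x.
by rewrite !L2fun_mulcE mul1r.
Qed.

Lemma cscaleDr (c : R[i]) u v : cscale c (u + v) = cscale c u + cscale c v.
Proof.
rewrite -[u]reprK -[v]reprK -pi_L2D !cscale_pi -pi_L2D; apply/pi_L2P; apply: aeW => x.
by rewrite L2funDE !L2fun_mulcE L2funDE mulrDr.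
Qed.

Lemma cscaleDl (b c : R[i]) v : cscale (b + c) v = cscale b v + cscale c v.
Proof.
rewrite -[v]reprK !cscale_pi -pi_L2D; apply/pi_L2P; apply: aeW => x.
by rewrite L2funDE !L2fun_mulcE mulrDl.
Qed.

Definition rscale (a : R) : L2 -> L2 := cscale a%:C%C.

Let rscaleA a b v : rscale a (rscale b v) = rscale (a * b) v.
Proof. by rewrite /rscale cscaleA -rmorphM. Qed.

Let rscale1 : left_id 1 rscale.
Proof. by move=> v; rewrite /rscale rmorph1 cscale1. Qed.

Let rscaleDr : right_distributive rscale +%R.
Proof. by move=> c u v; exact: cscaleDr. Qed.

Let rscaleDl v : {morph rscale^~ v : a b / a + b}.
Proof. by move=> a b; rewrite /rscale rmorphD cscaleDl. Qed.

HB.instance Definition _ := GRing.Zmodule_isLmodule.Build R L2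
  rscaleA rscale1 rscaleDr rscaleDl.

Lemma L2scaleE (a : R) (v : L2) : a *: v = cscale a%:C%C v.
Proof. by []. Qed.

Definition L2norm (v : L2) : R := fine (L2_norm (repr v)).

Lemma L2norm_pi (f : L2fun) : (L2norm (\pi_L2 f))%:E = L2_norm f.
Proof.
have /L2_predP[mr lr] := valP (repr (\pi_L2 f)).
have /L2_predP[mf lf] := valP f.
rewrite /L2norm fineK; last by rewrite ge0_fin_numE ?Lnorm_ge0.
apply: ae_eq_Lnorm2; [exact: measurable_cabs|exact: measurable_cabs|].
by apply: filterS (repr_L2 f) => x ->.
Qed.

Let L2normD (u v : L2) : L2norm (u + v) <= L2norm u + L2norm v.
Proof.
rewrite -[u]reprK -[v]reprK -pi_L2D -lee_fin EFinD !L2norm_pi.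
have /L2_predP[mu_ _] := valP (repr u).
have /L2_predP[mv _] := valP (repr v).
exact: L2_normD.
Qed.

Lemma L2norm_cscale (c : R[i]) (v : L2) :
  L2norm (cscale c v) = cabs c * L2norm v.
Proof.
rewrite -[v]reprK cscale_pi; apply: EFin_inj; rewrite EFinM !L2norm_pi.
have /L2_predP[mv _] := valP (repr v).
exact: L2_normM.
Qed.

Let L2normZ (a : R) (v : L2) : L2norm (a *: v) = `|a| * L2norm v.
Proof.
by rewrite L2scaleE L2norm_cscale /cabs/= expr0n/= addr0 sqrtr_sqr.
Qed.

Let L2norm0_eq0 (v : L2) : L2norm v = 0 -> v = 0.
Proof.
rewrite -[v]reprK => v0.
have {v0} : (L2norm (\pi_L2 (repr v)))%:E = 0%:E by rewrite v0.
rewrite L2norm_pi.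
have /L2_predP[mv _] := valP (repr v).
move=> N0; have -> : 0 = \pi_L2 0 :> L2 by rewrite piE.
have mE : measurable_fun setT (fun x => (cabs (repr v x))%:E).
  by apply/measurable_EFinP; exact: measurable_cabs.
apply/pi_L2P; have := Lnorm_eq0_eq0 mE _ N0.
rewrite lte_fin => /(_ (ltr0n _ 2)).
by apply: filterS => x /(_ I) [] /cabs0_eq0.
Qed.

HB.instance Definition _ := Lmodule_isNormed.Build R L2
  L2normD L2normZ L2norm0_eq0.

Lemma L2_normE (v : L2) : `|v| = L2norm v.
Proof. by []. Qed.

(* v is the class of the function F *)
Definition L2class (v : L2) (F : T -> R[i]) : Prop :=
  {ae mu, forall x, F x = repr v x}.

End ComplexL2.
Definition measure_rV_display : measure_display -> measure_display.
Proof. exact. Qed.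

Section measurable_rV.
Context {d} {T : measurableType d}.
Variable n : nat.

Let coord (i : 'I_n) (x : 'rV[T]_n) : T := x ord0 i.

Let rV_set0 : g_sigma_preimage coord set0.
Proof. exact: sigma_algebra0. Qed.

Let rV_setC A : g_sigma_preimage coord A -> g_sigma_preimage coord (~` A).
Proof. exact: sigma_algebraC. Qed.

Let rV_bigcup (F : _^nat) : (forall i, g_sigma_preimage coord (F i)) ->
  g_sigma_preimage coord (\bigcup_i (F i)).
Proof. exact: sigma_algebra_bigcup. Qed.

HB.instance Definition _ := @isMeasurable.Build (measure_rV_display d)
  'rV[T]_n (g_sigma_preimage coord) rV_set0 rV_setC rV_bigcup.

Lemma measurable_coord (i : 'I_n) :
  measurable_fun [set: 'rV[T]_n] (fun x : 'rV[T]_n => x ord0 i).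
Proof.
move=> _ Y mY; rewrite setTI; apply: sub_sigma_algebra => /=.
rewrite -bigcup_seq/=; exists i => /=; first by rewrite mem_index_enum.
by exists Y => //; rewrite setTI.
Qed.

Lemma measurable_fun_rV d1 (T1 : measurableType d1) (f : T1 -> 'rV[T]_n) :
  (forall i, measurable_fun [set: T1] (fun t => f t ord0 i)) ->
  measurable_fun [set: T1] f.
Proof.
move=> mf _ Y mY; rewrite setTI.
pose G := [set A : set 'rV[T]_n | measurable (f @^-1` A)].
suff : g_sigma_preimage coord `<=` G by exact.
apply: smallest_sub.
  split.
  - by rewrite /G/= preimage_set0.
  - by move=> A; rewrite /G/= setTD preimage_setC; exact: measurableC.
  - by move=> F mF; rewrite /G/= preimage_bigcup; exact: bigcupT_measurable.
rewrite -bigcup_seq => A [i _ [B mB <-]].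
by have := mf i measurableT B mB; rewrite /G/= !setTI.
Qed.

End measurable_rV.

Section LebesgueRn.
Context {R : realType}.
Local Open Scope ereal_scope.

Definition cons_rV n (p : measurableTypeR R * 'rV[R]_n) : 'rV[R]_n.+1 :=
  \row_i (if unlift ord0 i is Some j then p.2 ord0 j else p.1).

Definition uncons_rV n (x : 'rV[R]_n.+1) : measurableTypeR R * 'rV[R]_n :=
  (x ord0 ord0, \row_j x ord0 (lift ord0 j)).

Lemma cons_rVK n : cancel (@cons_rV n) (@uncons_rV n).
Proof.
move=> [a x]; congr pair; first by rewrite mxE unlift_none.
by apply/rowP => j; rewrite !mxE liftK.
Qed.

Lemma measurable_cons_rV n : measurable_fun [set: measurableTypeR R * 'rV[R]_n] (@cons_rV n).
Proof.
apply: measurable_fun_rV => i.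
have [j ->|->] := unliftP (ord0 : 'I_n.+1) i.
  rewrite (_ : (fun t => _) = (fun x : 'rV[R]_n => x ord0 j) \o snd).
    by apply: measurableT_comp => //; exact: measurable_coord.
  by apply/funext => p; rewrite mxE liftK.
rewrite (_ : (fun t => _) = fst)//.
by apply/funext => p; rewrite mxE unlift_none.
Qed.

Lemma measurable_uncons_rV n : measurable_fun [set: 'rV[R]_n.+1] (@uncons_rV n).
Proof.
apply/measurable_fun_pairP; split; first exact: measurable_coord.
apply: measurable_fun_rV => j.
rewrite (_ : (fun t => _) = (fun t : 'rV[R]_n.+1 => t ord0 (lift ord0 j))).
  exact: measurable_coord.
by apply/funext => x; rewrite /= mxE.
Qed.

Section step.
Variables (n : nat) (m : {sigma_finite_measure set 'rV[R]_n -> \bar R}).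

Definition leb_step (A : set 'rV[R]_n.+1) : \bar R :=
  (lebesgue_measure \x m) (@cons_rV n @^-1` A).

Let leb_step0 : leb_step set0 = 0.
Proof. by rewrite /leb_step preimage_set0 measure0. Qed.

Let leb_step_ge0 A : 0 <= leb_step A.
Proof. exact: measure_ge0. Qed.

Let mcons A : measurable A -> measurable (@cons_rV n @^-1` A).
Proof.
by move=> mA; rewrite -[X in measurable X]setTI; exact: measurable_cons_rV.
Qed.

Let leb_step_sigma_additive : semi_sigma_additive leb_step.
Proof.
move=> F mF tF mUF; rewrite /leb_step preimage_bigcup.
apply: measure_semi_sigma_additive.
- by move=> k; exact: mcons.
- apply/trivIsetP => /= i j _ _ ij; rewrite -preimage_setI.
  by move/trivIsetP : tF => /(_ _ _ _ _ ij) ->//; rewrite preimage_set0.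
- by rewrite -preimage_bigcup; exact: mcons.
Qed.

HB.instance Definition _ := isMeasure.Build _ _ _ leb_step
  leb_step0 leb_step_ge0 leb_step_sigma_additive.

Let leb_step_sigma_finite : sigma_finite setT leb_step.
Proof.
have /sigma_finiteP[F [TF ndF Foo]] := sigma_finiteT (@lebesgue_measure R).
have /sigma_finiteP[G [TG ndG Goo]] := sigma_finiteT m.
exists (fun k => @uncons_rV n @^-1` (F k `*` G k)).
  rewrite -preimage_bigcup (_ : \bigcup_i _ = setT) ?preimage_setT//.
  rewrite -subTset => -[x y] _.
  have [i _ Fix] : (\bigcup_i F i) x by rewrite -TF.
  have [j _ Gjy] : (\bigcup_i G i) y by rewrite -TG.
  exists (maxn i j) => //; split => /=.
    by move: x Fix; exact/subsetPset/ndF/leq_maxl.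
  by move: y Gjy; exact/subsetPset/ndG/leq_maxr.
move=> k; have [mF Fk] := Foo k; have [mG Gk] := Goo k; split.
  rewrite -[X in measurable X]setTI; apply: measurable_uncons_rV => //.
  exact: measurableX.
rewrite /leb_step -comp_preimage (_ : _ \o _ = id); last first.
  by apply/funext => p /=; rewrite cons_rVK.
by rewrite preimage_id product_measure1E// lte_mul_pinfty// ge0_fin_numE.
Qed.

HB.instance Definition _ := Measure_isSigmaFinite.Build _ _ _ leb_step
  leb_step_sigma_finite.

End step.

(* Lebesgue measure on R^n, by recursion on n *)
Fixpoint lebesgue_rV (n : nat) : {sigma_finite_measure set 'rV[R]_n -> \bar R} :=
  if n is n'.+1 then leb_step (lebesgue_rV n') else dirac (0%R : 'rV[R]_0).

End LebesgueRn.
Section SL2cover.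
Context {R : realType}.

Definition ray (t : R) : 'cV[R]_2 := \col_i (if i == 0 then cos t else sin t).

(* An element of the universal covering group of SL(2,R) is a matrix of
   determinant 1 together with a lift to R of its action on the circle of rays
   { R_+ (cos t, sin t) }; the lifts of a given matrix differ by 2 pi Z. *)
Record SL2cover := MkSL2cover {
  SL2mat : 'M[R]_2;
  lift : R -> R;
  liftV : R -> R;
  SL2_det : \det SL2mat = 1;
  lift_cont : continuous lift;
  liftV_cont : continuous liftV;
  liftK : cancel lift liftV;
  liftVK : cancel liftV lift;
  liftP : forall t, exists2 r, 0 < r & SL2mat *m ray t = r *: ray (lift t) }.

Lemma SL2cover_eq (g h : SL2cover) :
  SL2mat g = SL2mat h -> lift g = lift h -> g = h.
Proof.
case: g => A f f' d c c' K K' P; case: h => B f1 f1' d1 c1 c1' K1 K1' P1 /= AB.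
subst B => ff1; subst f1.
have f'E : f' = f1' by apply/funext => t; rewrite -[in LHS](K1' t) K.
subst f1'; congr MkSL2cover; exact: Prop_irrelevance.
Qed.

HB.instance Definition _ := gen_eqMixin SL2cover.
HB.instance Definition _ := gen_choiceMixin SL2cover.

Program Definition SL2one : SL2cover :=
  @MkSL2cover 1%:M id id _ _ _ _ _ _.
Next Obligation. exact: det1. Qed.
Next Obligation. by move=> x; exact: cvg_id. Qed.
Next Obligation. by move=> x; exact: cvg_id. Qed.
Next Obligation. by []. Qed.
Next Obligation. by []. Qed.
Next Obligation. by exists 1 => //; rewrite mul1mx scale1r. Qed.

Program Definition SL2mul (g h : SL2cover) : SL2cover :=
  @MkSL2cover (SL2mat g *m SL2mat h) (lift g \o lift h) (liftV h \o liftV g)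
    _ _ _ _ _ _.
Next Obligation. by move=> g h; rewrite det_mulmx !SL2_det mulr1. Qed.
Next Obligation.
by move=> g h x; apply: continuous_comp; exact: lift_cont.
Qed.
Next Obligation.
by move=> g h x; apply: continuous_comp; exact: liftV_cont.
Qed.
Next Obligation. by move=> g h t /=; rewrite !liftK. Qed.
Next Obligation. by move=> g h t /=; rewrite !liftVK. Qed.
Next Obligation.
move=> g h t /=.
have [r r0 hr] := liftP h t; have [s s0 gs] := liftP g (lift h t).
exists (r * s); first exact: mulr_gt0.
by rewrite -mulmxA hr -scalemxAr gs scalerA.
Qed.

Program Definition SL2inv (g : SL2cover) : SL2cover :=
  @MkSL2cover (invmx (SL2mat g)) (liftV g) (lift g) _ _ _ _ _ _.
Next Obligation. by move=> g; rewrite det_inv SL2_det invr1. Qed.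
Next Obligation. by move=> g; exact: liftV_cont. Qed.
Next Obligation. by move=> g; exact: lift_cont. Qed.
Next Obligation. by move=> g; exact: liftVK. Qed.
Next Obligation. by move=> g; exact: liftK. Qed.
Next Obligation.
move=> g t /=; have [r r0 gr] := liftP g (liftV g t).
exists r^-1; first by rewrite invr_gt0.
have gU : SL2mat g \in unitmx by rewrite unitmxE SL2_det unitr1.
rewrite -[t in LHS](liftVK g) -[X in _ *m X](scalerK (lt0r_neq0 r0)) -gr.
by rewrite -scalemxAr mulKmx.
Qed.

Let SL2mulA : associative SL2mul.
Proof. by move=> g h k; apply: SL2cover_eq => //=; exact: mulmxA. Qed.

Let SL2mul1g : left_id SL2one SL2mul.
Proof. by move=> g; apply: SL2cover_eq => //=; exact: mul1mx. Qed.

Let SL2mulg1 : right_id SL2one SL2mul.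
Proof. by move=> g; apply: SL2cover_eq => //=; exact: mulmx1. Qed.

Let SL2mulVg : left_inverse SL2one SL2inv SL2mul.
Proof.
move=> g; apply: SL2cover_eq => /=; last by apply/funext => t /=; exact: liftK.
by rewrite mulVmx// unitmxE SL2_det unitr1.
Qed.

Let SL2mulgV : right_inverse SL2one SL2inv SL2mul.
Proof.
move=> g; apply: SL2cover_eq => /=; last by apply/funext => t /=; exact: liftVK.
by rewrite mulmxV// unitmxE SL2_det unitr1.
Qed.

HB.instance Definition _ := isGroup.Build SL2cover
  SL2mulA SL2mul1g SL2mulg1 SL2mulVg SL2mulgV.

HB.instance Definition _ := Topological.copy SL2cover
  (initial_topology (fun g : SL2cover =>
     (SL2mat g, lift g : {ptws R -> R}) : 'M[R]_2 * {ptws R -> R})).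

Lemma SL2matM (g h : SL2cover) : SL2mat (g * h)%g = SL2mat g *m SL2mat h.
Proof. by []. Qed.

Lemma liftM (g h : SL2cover) : lift (g * h)%g = lift g \o lift h.
Proof. by []. Qed.

(* The one-parameter subgroup with initial velocity X in sl(2,R), the Lie
   algebra of the cover being that of SL(2,R). *)
Definition one_parameter_subgroup (X : 'M[R]_2) (gamma : R -> SL2cover) :=
  [/\ forall s t, gamma (s + t) = (gamma s * gamma t)%g,
      continuous gamma &
      is_derive (0 : R) 1 (fun s => SL2mat (gamma s)) X].

Definition expSL2 (X : 'M[R]_2) : SL2cover :=
  xget 1%g [set g | exists2 gamma, one_parameter_subgroup X gamma &
                                   g = gamma 1].

End SL2cover.
Arguments SL2cover : clear implicits.

Section smooth_maps.
Context {R : realType}.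

(* f is of class C^n on the open set O *)
Fixpoint Cn (U V : normedModType R) (n : nat) (O : set U) (f : U -> V) : Prop :=
  {in O, continuous f} /\
  (if n is n'.+1 then
    forall v, (forall x, O x -> derivable f x v) /\ Cn n' O (fun x => 'D_v f x)
   else True).

(* SL(2,R) is embedded in the 2 x 2 matrices and its cover is locally
   diffeomorphic to it: a map is smooth if locally it is the pull-back of a
   smooth function of the matrix. *)
Definition smooth_on_SL2cover (V : normedModType R) (F : SL2cover R -> V) :=
  forall g : SL2cover R, exists (O : set 'M[R]_2) (f : 'M[R]_2 -> V),
    [/\ open O, O (SL2mat g), forall n, Cn n O f &
        \forall h \near g, F h = f (SL2mat h)].

End smooth_maps.
Section Dunkl.
Context {R : realType} {N : nat}.
Implicit Types (x y alpha beta : 'rV[R]_N) (f F : 'rV[R]_N -> R[i]).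

(* Euclidean inner product and norm; `|x| is the sup norm on matrices *)
Definition dot x y : R := \sum_i x ord0 i * y ord0 i.
Definition enorm x : R := Num.sqrt (dot x x).

Definition reflection alpha x : 'rV[R]_N :=
  x - (2 * dot alpha x / dot alpha alpha) *: alpha.

Record reduced_root_system (RS : {fset 'rV[R]_N}) : Prop := {
  root_neq0 : 0 \notin RS;
  root_reflection : forall alpha beta,
    alpha \in RS -> beta \in RS -> reflection alpha beta \in RS;
  root_reduced : forall alpha beta, alpha \in RS ->
    (beta \in RS /\ exists c, beta = c *: alpha) <->
    beta = alpha \/ beta = - alpha }.

Definition multiplicity_function (RS : {fset 'rV[R]_N}) (k : 'rV[R]_N -> R) :=
  forall alpha beta, alpha \in RS -> beta \in RS ->
    k (reflection alpha beta) = k beta.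

(* derivative along v of a complex function of real variables *)
Definition cderive f x (v : 'rV[R]_N) : R[i] :=
  Complex ('D_v (fun y => complex.Re (f y)) x)
          ('D_v (fun y => complex.Im (f y)) x).

Definition partial (j : 'I_N) f x : R[i] := cderive f x (delta_mx ord0 j).

Variables (RS : {fset 'rV[R]_N}) (k : 'rV[R]_N -> R) (a : R).

Definition index_k : R := 2^-1 * \sum_(alpha <- RS) k alpha.

(* (f(x) - f(r_alpha x)) / <alpha, x>, extended by continuity to the
   hyperplane <alpha, x> = 0 *)
Definition reflection_quotient alpha f x : R[i] :=
  if dot alpha x == 0 then (2 / dot alpha alpha)%:C%C * cderive f x alpha
  else (f x - f (reflection alpha x)) / (dot alpha x)%:C%C.

Definition dunkl_op (j : 'I_N) f x : R[i] :=
  partial j f x + 2^-1 * \sum_(alpha <- RS)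
    (k alpha * alpha ord0 j)%:C%C * reflection_quotient alpha f x.

Definition dunkl_laplacian f x : R[i] :=
  \sum_j dunkl_op j (dunkl_op j f) x.

Definition euler_op f x : R[i] := \sum_j (x ord0 j)%:C%C * partial j f x.

Definition homogeneous_polynomial (m : nat) f :=
  exists c : {ffun 'I_N -> 'I_m.+1} -> R[i], forall x,
    f x = \sum_(e : {ffun 'I_N -> 'I_m.+1} | (\sum_i e i == m)%N)
            c e * (\prod_i x ord0 i ^+ e i)%:C%C.

Definition harmonic_polynomial (m : nat) f :=
  homogeneous_polynomial m f /\ forall x, dunkl_laplacian f x = 0.

Definition lambda (m : nat) : R :=
  (2 * m%:R + 2 * index_k + N%:R - 2) / a.

Definition Gamma (s : R) : R :=
  (\int[lebesgue_measure]_(t in `]0%R, +oo[) (t `^ (s - 1) * expR (- t)))%R.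

(* binomial coefficient of real upper argument *)
Definition gbinom (s : R) (n : nat) : R :=
  (\prod_(i < n) (s - i%:R)) / n`!%:R.

Definition laguerre (l : nat) (s t : R) : R :=
  \sum_(j < l.+1) (-1) ^+ j / j`!%:R * gbinom (s + l%:R) (l - j) * t ^+ j.

Definition radial (m l : nat) (r : R) : R :=
  Num.sqrt (2 `^ (lambda m + 1) * Gamma (l%:R + 1) /
            (a `^ lambda m * Gamma (lambda m + l%:R + 1))) *
  r ^+ m * laguerre l (lambda m) (2 / a * r `^ a) * expR (- (r `^ a / a)).

(* (p (x) f)(r omega) = p(omega) f(r) *)
Definition polar_tensor f (g : R -> R) x : R[i] :=
  f ((enorm x)^-1 *: x) * (g (enorm x))%:C%C.

(* algebraic span of the p (x) f_{k,a,m;l}, as functions *)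
Definition W_space : set ('rV[R]_N -> R[i]) :=
  [set F | exists (n : nat) (m l : 'I_n -> nat)
                  (p : 'I_n -> 'rV[R]_N -> R[i]),
    (forall i, harmonic_polynomial (m i) (p i)) /\
    forall x, F x = \sum_i polar_tensor (p i) (radial (m i) (l i)) x].

Definition weight x : R :=
  enorm x `^ (a - 2) * \prod_(alpha <- RS) `|dot alpha x| `^ k alpha.

Lemma weight_ge0 x : 0 <= weight x.
Proof.
by rewrite mulr_ge0 ?powR_ge0// prodr_ge0// => alpha _; exact: powR_ge0.
Qed.

Lemma measurable_dot alpha : measurable_fun [set: 'rV[R]_N] (dot alpha).
Proof.
rewrite /dot; apply: measurable_sum => i.
by apply: measurable_funM => //; exact: measurable_coord.
Qed.

Lemma measurable_weight : measurable_fun [set: 'rV[R]_N] weight.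
Proof.
apply: measurable_funM; last first.
  apply: measurable_prod => alpha _.
  apply: (@measurableT_comp _ _ _ _ _ _ (@powR R ^~ (k alpha))).
    exact: measurable_powR.
  by apply: measurableT_comp => //; exact: measurable_dot.
apply: (@measurableT_comp _ _ _ _ _ _ (@powR R ^~ (a - 2))).
  exact: measurable_powR.
apply: (@measurableT_comp _ _ _ _ _ _ (@Num.sqrt R)).
  by apply: continuous_measurable_fun; exact: sqrt_continuous.
apply: measurable_sum => i.
by apply: measurable_funM; exact: measurable_coord.
Qed.

Definition weighted_measure (A : set 'rV[R]_N) : \bar R :=
  (\int[lebesgue_rV N]_(x in A) (weight x)%:E)%E.

Let weighted_measure0 : weighted_measure set0 = 0%E.
Proof. exact: integral_set0. Qed.

Let weighted_measure_ge0 A : (0 <= weighted_measure A)%E.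
Proof. by apply: integral_ge0 => x _; rewrite lee_fin weight_ge0. Qed.

Let weighted_measure_sigma_additive : semi_sigma_additive weighted_measure.
Proof.
apply: semi_sigma_additive_nng_induced.
  by apply/measurable_EFinP; exact: measurable_weight.
by move=> x; rewrite lee_fin weight_ge0.
Qed.

HB.instance Definition _ := isMeasure.Build _ _ _ weighted_measure
  weighted_measure0 weighted_measure_ge0 weighted_measure_sigma_additive.

Definition omega_h F x : R[i] :=
  (2 / a)%:C%C * euler_op F x +
  ((2 * index_k + a + N%:R - 2) / a)%:C%C * F x.

Definition omega_plus F x : R[i] :=
  'i%C * (a^-1 * enorm x `^ a)%:C%C * F x.

Definition omega_minus F x : R[i] :=
  'i%C * (a^-1 * enorm x `^ (2 - a))%:C%C * dunkl_laplacian F x.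

(* X = X_00 h + X_01 e^+ + X_10 e^- when X has trace 0 *)
Definition omega (X : 'M[R]_2) F x : R[i] :=
  (X 0 0)%:C%C * omega_h F x + (X 0 1)%:C%C * omega_plus F x +
  (X 1 0)%:C%C * omega_minus F x.

End Dunkl.

Section representations.
Context {R : realType} d (T : measurableType d).
Variable mu : {measure set T -> \bar R}.
Local Notation H := (L2 mu).
Implicit Types (rho : SL2cover R -> H -> H) (v : H).

Record unitary_representation rho : Prop := {
  rep_1 : forall v, rho 1%g v = v;
  rep_M : forall g h v, rho (g * h)%g v = rho g (rho h v);
  rep_D : forall g u v, rho g (u + v) = rho g u + rho g v;
  rep_Z : forall g (c : R[i]) v, rho g (cscale c v) = cscale c (rho g v);
  rep_isometry : forall g v, `|rho g v| = `|v|;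
  rep_continuous : forall v, continuous (fun g => rho g v) }.

Definition smooth_vectors rho : set H :=
  [set v | smooth_on_SL2cover (fun g => rho g v)].

(* the Lie subgroup with Lie algebra so(2) *)
Definition SO2cover : set (SL2cover R) :=
  [set expSL2 X | X in [set X : 'M[R]_2 | X^T = - X]].

Definition SO2_finite rho v :=
  exists (n : nat) (b : 'I_n -> H), forall g, SO2cover g ->
    exists c : 'I_n -> R[i], rho g v = \sum_i cscale (c i) (b i).

Definition infinitesimal_action rho (X : 'M[R]_2) v w :=
  is_derive (0 : R) 1 (fun s => rho (expSL2 (s *: X)) v) w.

End representations.

Section generalized_Fourier.
Context {R : realType} {N : nat}.
Variables (RS : {fset 'rV[R]_N}) (k : 'rV[R]_N -> R) (a : R).
Local Notation H := (L2 (weighted_measure RS k a)).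
Implicit Types Omega : SL2cover R -> H -> H.

(* the properties characterizing Omega_{k,a} *)
Record is_Omega Omega : Prop := {
  Omega_unitary : unitary_representation Omega;
  Omega_finite : forall v, SO2_finite Omega v <->
    exists2 F, W_space RS k a F & L2class v F;
  Omega_infinitesimal : forall (X : 'M[R]_2) F v, \tr X = 0 ->
    W_space RS k a F -> L2class v F ->
    exists2 w, L2class w (omega RS k a X F) & infinitesimal_action Omega X v w }.

Definition rot_generator : 'M[R]_2 :=
  \matrix_(i, j) (if i == j then 0 else if i == 0 then -1 else 1).

Definition Fourier Omega (v : H) : H :=
  let theta := pi / 2 * (lambda RS k a 0 + 1) in
  cscale (Complex (cos theta) (sin theta))
    (Omega (expSL2 ((pi / 2) *: rot_generator)) v).

Definition Schwartz Omega : set H := smooth_vectors Omega.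

End generalized_Fourier.

(* Main.v *)
(* The Fourier transform is a scalar multiple of Omega(h) for one group element
   h. Since Omega(g) Omega(h) v = Omega(g h) v, the orbit map of Omega(h) v is
   the orbit map of v precomposed with the right translation by h, which in the
   matrix coordinate is the linear map A |-> A *m SL2mat h. *)

Require Import Defs.
From HB Require Import structures.
From mathcomp Require Import all_boot all_order all_algebra finmap.
From mathcomp Require Import complex.
From mathcomp Require Import all_classical all_reals all_analysis.

Import Order.TTheory GRing.Theory Num.Theory.
Import numFieldNormedType.Exports.

Local Open Scope classical_set_scope.
Local Open Scope ring_scope.

Section smooth_linear_comp.
Context {R : realType} {U U' V V' : normedModType R}.
Variables (M : {linear U' -> U}) (L : {linear V -> V'}).
Hypotheses (cM : continuous M) (cL : continuous L).

(** By linearity, the difference quotient of [L \o f \o M] at [x] along [v] is exactly [L] of the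
    quotient of [f] at [M x] along [M v]; continuity of [L] passes to the limit. *)
Lemma is_derive_linear_comp (f : U -> V) (x v : U') :
  derivable f (M x) (M v) ->
  is_derive x v (L \o f \o M) (L ('D_(M v) f (M x))).
Proof.
move=> df.
have quot_cvg : (fun h => h^-1 *: ((L \o f \o M \o shift x) (h *: v) -
    (L \o f \o M) x)) @ 0^' --> L ('D_(M v) f (M x)).
  rewrite (_ : (fun h => _) = L \o (fun h : R =>
      h^-1 *: ((f \o shift (M x)) (h *: M v) - f (M x)))); last first.
    apply/funext => h /=.
    by rewrite (linearD M) (linearZ_LR M) (linearZ_LR L) (linearB L).
  by apply: continuous_cvg; [exact: cL|exact: df].
apply: DeriveDef; last exact: cvg_lim quot_cvg.
by apply/cvg_ex; eexists; exact: quot_cvg.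
Qed.

Lemma continuous_in_linear_comp (O : set U) (f : U -> V) :
  {in O, continuous f} -> {in M @^-1` O, continuous (L \o f \o M)}.
Proof.
move=> cf x /set_mem xO; apply: continuous_comp; first exact: cM.
by apply: continuous_comp; [apply: cf; exact: mem_set|exact: cL].
Qed.

End smooth_linear_comp.

(** Derivatives are local, so functions agreeing on an open set have derivatives agreeing there, and
    induction on [n] applies. *)
Lemma Cn_eq {R : realType} {U V : normedModType R} (n : nat) (O : set U)
    (f g : U -> V) :
  open O -> {in O, f =1 g} -> Cn n O f -> Cn n O g.
Proof.
move=> oO.
have near_eq (u w : U -> V) x : {in O, u =1 w} -> O x -> \near x, u x = w x.
  move=> uw Ox; near=> y; apply/uw/mem_set; near: y.
  exact: open_nbhs_nbhs.
have eq_cont (u w : U -> V) :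
    {in O, u =1 w} -> {in O, continuous u} -> {in O, continuous w}.
  move=> uw cu x xO; rewrite /continuous_at -(uw x xO).
  by apply: cvg_trans (cu x xO); apply/near_eq_cvg/near_eq; [|exact: set_mem].
elim: n f g => [|n IH] f g fg /= [cf df].
  by split=> //; exact: eq_cont cf.
split=> [|v]; first exact: eq_cont cf.
have [dfv Cfv] := df v; split=> [x Ox|].
  by apply: near_eq_derivable (dfv x Ox); exact: near_eq.
by apply: IH Cfv => x /set_mem Ox; apply: near_eq_derive; exact: near_eq.
Unshelve. all: by end_near. Qed.

(** The derivative along [v] is [L \o 'D_(M v) f \o M], again of the composite shape, so the
    induction runs over all [f]. *)
Lemma Cn_linear_comp {R : realType} {U U' V V' : normedModType R}
    (M : {linear U' -> U}) (L : {linear V -> V'}) (n : nat) (O : set U)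
    (f : U -> V) :
  continuous M -> continuous L -> open O ->
  Cn n O f -> Cn n (M @^-1` O) (L \o f \o M).
Proof.
move=> cM cL oO; elim: n f => [|n IH] f /= [cf df].
  by split=> //; exact: continuous_in_linear_comp.
split=> [|v]; first exact: continuous_in_linear_comp.
have [dfv Cfv] := df (M v).
have dLfM x : O (M x) -> is_derive x v (L \o f \o M) (L ('D_(M v) f (M x))).
  by move=> Ox; apply: is_derive_linear_comp => //; exact: dfv.
split=> [x Ox|]; first by have [] := dLfM x Ox.
(* The derivative formula is known only on the preimage of [O], hence the transfer by [Cn_eq]. *)
apply: Cn_eq (IH _ Cfv) => [|x /set_mem Ox].
  exact: open_comp.
by have [_ ->] := dLfM x Ox.
Qed.

(** A neighbourhood of a matrix contains a box of entry neighbourhoods, which imposes only finitely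
    many conditions. *)
Lemma cvg_mx {T : Type} {K : topologicalType} {m n : nat} {F : set_system T}
    {FF : Filter F} (f : T -> 'M[K]_(m, n)) (A : 'M[K]_(m, n)) :
  (forall i j, (fun t => f t i j) @ F --> A i j) -> f @ F --> A.
Proof.
move=> fA B [P AP PB].
apply: (@filterS _ F _ (fun t => forall i j, P i j (f t i j))).
  by move=> t; exact: PB.
by apply: filter_forall => i; apply: filter_forall => j; exact: fA.
Qed.

Lemma mulmxr_continuous {R : realType} {m n p : nat} (B : 'M[R]_(n, p)) :
  continuous (fun A : 'M[R]_(m, n) => A *m B).
Proof.
move=> A; apply: (@cvg_mx _ _ _ _ (nbhs A) _) => i j.
under eq_fun do rewrite mxE.
rewrite mxE; apply: cvg_big => [|l _]; first exact: add_continuous.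
by apply: cvgMl; exact: coord_continuous.
Qed.

Section cscale_linear.
Context {R : realType} {d} {T : measurableType d}.
Context {mu : {measure set T -> \bar R}}.
Variable c : R[i].

(** Linearity is over the reals, the scalars of the normed space [L2 mu]; complex scalars commute
    with them. *)
Let cscale_is_linear : linear (Defs.cscale c : L2 mu -> L2 mu).
Proof.
by move=> b u v; rewrite cscaleDr !L2scaleE !cscaleA mulrC.
Qed.

HB.instance Definition _ := GRing.isLinear.Build R (L2 mu) (L2 mu) _
  (Defs.cscale c) cscale_is_linear.

Lemma cscale_continuous : continuous (Defs.cscale c : L2 mu -> L2 mu).
Proof.
apply: bounded_linear_continuous; apply/linear_boundedP.
exists (cabs c); split=> [|r /ltW cr v]; first exact: num_real.
by rewrite [leLHS]L2norm_cscale -L2_normE ler_wpM2r.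
Qed.

End cscale_linear.

Section right_translation.
Context {R : realType}.

(** This is the map whose initial topology [SL2cover R] carries. *)
Let mat_lift (g : SL2cover R) : 'M[R]_2 * {ptws R -> R} :=
  (SL2mat g, Defs.lift g : {ptws R -> R}).

Let mat_lift_continuous : continuous mat_lift.
Proof. exact: initial_continuous. Qed.

Let SL2mat_continuous : continuous (@SL2mat R).
Proof.
move=> g; apply: (@continuous_comp _ _ _ mat_lift fst).
  exact: mat_lift_continuous.
exact: cvg_fst.
Qed.

Let lift_continuous (t : R) : continuous (fun g : SL2cover R => Defs.lift g t).
Proof.
move=> g.
have Flift : Filter (@Defs.lift R @ g) := fmap_filter _ (nbhs_filter g).
apply: (iffLR (pointwise_cvgP _ Flift)).
apply: (@continuous_comp _ _ _ mat_lift snd).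
  exact: mat_lift_continuous.
exact: cvg_snd.
Qed.

Lemma SL2cover_mulr_continuous (h : SL2cover R) :
  continuous (fun g : SL2cover R => (g * h)%g).
Proof.
suff cmul : continuous (fun g : SL2cover R => mat_lift (g * h)%g).
  (* Open sets of the cover are the preimages under [mat_lift] of open sets [B]. *)
  by apply/continuousP => _ [B oB <-]; move/continuousP : cmul; exact.
move=> g; have Fg : Filter (nbhs g) := nbhs_filter g.
have matP : (fun g' => SL2mat (g' * h)%g) @ g --> SL2mat (g * h)%g.
  apply: (@continuous_comp _ _ _ (@SL2mat R) (fun A => A *m SL2mat h)).
    exact: SL2mat_continuous.
  exact: mulmxr_continuous.
have Flift : Filter ((fun g' : SL2cover R => Defs.lift (g' * h)%g) @ g).
  exact: fmap_filter.
have liftP :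
    {ptws, (fun g' => Defs.lift (g' * h)%g) @ g --> Defs.lift (g * h)%g}.
  apply: (iffRL (pointwise_cvgP _ Flift)) => t.
  exact: (@lift_continuous (Defs.lift h t) g).
have nbhs_liftP : Filter (nbhs (Defs.lift (g * h)%g : {ptws R -> R})).
  exact: nbhs_filter.
exact: (@cvg_pair _ _ _ _ (nbhs _) _ Fg _ nbhs_liftP _ _ matP liftP).
Qed.

(** A local matrix expression [f] of [F] around [g * h] yields one around [g], by right
    multiplication by [SL2mat h] inside and [L] outside. *)
Lemma smooth_on_SL2cover_mulr {V W : normedModType R} (L : {linear V -> W})
    (F : SL2cover R -> V) (h : SL2cover R) :
  continuous L -> smooth_on_SL2cover F ->
  smooth_on_SL2cover (fun g => L (F (g * h)%g)).
Proof.
move=> cL smF g; have [U0 [f [oU0 Ugh Cf Ff]]] := smF (g * h)%g.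
exists (mulmxr (SL2mat h) @^-1` U0), (L \o f \o mulmxr (SL2mat h)); split.
- apply: (@open_comp _ _ (mulmxr (SL2mat h))) => // A _.
  exact: mulmxr_continuous.
- exact: Ugh.
- by move=> n; apply: Cn_linear_comp => //; exact: mulmxr_continuous.
(* The identity valid near [g * h] pulls back to a neighbourhood of [g]. *)
- have := SL2cover_mulr_continuous h g _ Ff.
  by apply: (@filterS _ _ (nbhs_filter g)) => g' /= ->.
Qed.

End right_translation.

Theorem corollary4p4 (R : realType) (N : nat)
    (RS : {fset 'rV[R]_N}) (k : 'rV[R]_N -> R) (a : R)
    (Omega : SL2cover R -> L2 (weighted_measure RS k a) ->
             L2 (weighted_measure RS k a)) :
  (1 <= N)%N ->
  reduced_root_system RS ->
  multiplicity_function RS k ->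
  (forall alpha, alpha \in RS -> 0 <= k alpha) ->
  0 < a ->
  -1 < lambda RS k a 0 ->
  is_Omega Omega ->
  forall v, Schwartz Omega v -> Schwartz Omega (Fourier Omega v).
Proof.
move=> _ _ _ _ _ _ [[_ OmegaM _ OmegaZ _ _] _ _] v smv.
rewrite /Schwartz /smooth_vectors /= /Fourier.
set c := Complex _ _; set h := expSL2 _.
(* Complex linearity of [Omega g] moves the phase [c] outside, where it serves as the map [L]. *)
rewrite (_ : (fun g => _) = fun g => Defs.cscale c (Omega (g * h)%g v));
  last first.
  by apply/funext => g; rewrite OmegaZ OmegaM.
exact: (smooth_on_SL2cover_mulr (Defs.cscale c) _ h (cscale_continuous c) smv).
Qed.
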